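(* Let $\alpha\in[0,2)$ and fix $f\in\mathcal H$. Then: 1. If for some constant $A>0$ the inequality $\sigma_{f-f^*}(-\delta,\delta]\le A\delta^\alpha$ holds for all $\delta>0$, then for all real $t>s$ $$\|P_{t,s}f-f^*\|_{\mathcal H}^2\le B(t-s)^{-\alpha},\qquad\text{where one can take } B=\frac{2^{\alpha+1}}{2-\alpha}A.$$ 2. If for some constant $B>0$ the inequality $\|P_{t,s}f-f^*\|_{\mathcal H}^2\le B(t-s)^{-\alpha}$ holds for all real $t>s$, then for all $\delta>0$ $$\sigma_{f-f^*}(-\delta,\delta]\le A\delta^\alpha,\qquad\text{where } A=\frac{\rho(\alpha)}{2^\alpha}B\ \left(\le\frac{\pi^{2-\alpha}}{4}B\right).$$
   Context: $\mathcal H$ is a complex Hilbert space and $\{U^t\}_{t\in\mathbb R}$ is a strongly continuous group of unitary operators on $\mathcal H$. For $f\in\mathcal H$ and real $t>s$ put $P_{t,s}f=\frac1{t-s}\int_s^tU^\tau f\,d\tau$. $P$ is the orthogonal projection of $\mathcal H$ onto the subspace of vectors fixed by all $U^t$, and $f^*:=Pf$. By Stone's theorem $U^t=e^{it\mathbf B}$ with $\mathbf B$ self-adjoint; let $E$ be its spectral resolution, so that $(U^tf,g)_{\mathcal H}=\int_{\mathbb R}e^{it\lambda}\,d(E(\lambda)f,g)_{\mathcal H}$. For $h\in\mathcal H$, the spectral measure $\sigma_h$ is the finite Borel measure on $\mathbb R$ given by $\sigma_h(C)=\int_C d(E(\lambda)h,h)_{\mathcal H}$; $\sigma_h(-\delta,\delta]$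 denotes $\sigma_h((-\delta,\delta])$. For $\alpha\in[0,2]$, $\rho(\alpha)=\inf_{x>0}\frac{x^{2-\alpha}}{\sin^2x}$. *)

(* Defs.v *)
From HB Require Import structures.
From mathcomp Require Import all_boot all_order all_algebra.
From mathcomp Require Import complex.
From mathcomp Require Import all_classical all_reals all_analysis.
From mathcomp Require Import ring.

Set Implicit Arguments.
Unset Strict Implicit.
Unset Printing Implicit Defensive.

Import Order.TTheory GRing.Theory Num.Theory.
Import numFieldNormedType.Exports.

Local Open Scope classical_set_scope.
Local Open Scope ring_scope.
Local Open Scope complex_scope.

(* The inner product [dot] is linear in its first argument and conjugate-linear
   in the second one. *)
HB.mixin Record isHilbert (R : realType) (H : Type)
    of CompleteNormedModule R[i] H := {
  dot : {dot H for (@Num.conj R[i] : R[i] -> R[i])} ;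
  sqr_norm_dot : forall x : H, `|x| ^+ 2 = dot x x
}.

#[short(type="hilbertType")]
HB.structure Definition Hilbert (R : realType) :=
  { H of isHilbert R H & CompleteNormedModule R[i] H }.

(* Strong continuity is stated for each orbit; unitarity of each [U t] follows
   from preservation of [dot] and from the invertibility given by the group
   law. *)
Record is_unitary_group (R : realType) (H : hilbertType R)
    (U : R -> {linear H -> H}) : Prop := {
  unitary_group0 : forall x, U 0 x = x ;
  unitary_groupD : forall s t x, U (s + t) x = U s (U t x) ;
  unitary_group_dot : forall t x y, dot (U t x) (U t y) = dot x y ;
  unitary_group_continuous : forall x, continuous (fun t => U t x)
}.

Definition fixed_vectors (R : realType) (H : hilbertType R)
    (U : R -> {linear H -> H}) : set H :=
  [set x | forall t, U t x = x].

Definition is_orthogonal_projection (R : realType) (H : hilbertType R)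
    (S : set H) (P : H -> H) : Prop :=
  forall x, S (P x) /\ (forall y, S y -> dot (x - P x) y = 0).

(* [v] is the Riemann integral of [f] over [a, b]: the norm limit of the sums
   over the tagged partitions a = p 0 <= ... <= p n = b, p i <= c i <= p i.+1,
   as the mesh tends to 0. *)
Definition is_Riemann_integral (R : realType) (H : hilbertType R)
    (f : R -> H) (a b : R) (v : H) : Prop :=
  forall e : R, 0 < e -> exists2 d : R, 0 < d &
    forall (n : nat) (p c : nat -> R),
      p 0%N = a -> p n = b ->
      (forall i, (i < n)%N ->
        [/\ p i <= c i, c i <= p i.+1 & p i.+1 - p i < d]) ->
      `|(\sum_(0 <= i < n) (p i.+1 - p i)%:C *: f (c i)) - v| < e%:C.

Definition Riemann_integral (R : realType) (H : hilbertType R)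
    (f : R -> H) (a b : R) : H :=
  xget 0 [set v | is_Riemann_integral f a b v].

Definition ergodic_mean (R : realType) (H : hilbertType R)
    (U : R -> {linear H -> H}) (t s : R) (f : H) : H :=
  ((t - s)^-1)%:C *: Riemann_integral (fun tau => U tau f) s t.

(* A resolution of the identity, normalized to be strongly right-continuous. *)
Record spectralFamily (R : realType) (H : hilbertType R) := SpectralFamily {
  spectral_proj :> R -> {linear H -> H} ;
  spectral_proj_adj : forall l x y,
    dot (spectral_proj l x) y = dot x (spectral_proj l y) ;
  spectral_proj_comp : forall l m x,
    spectral_proj l (spectral_proj m x) = spectral_proj (Num.min l m) x ;
  spectral_proj_right_continuous : forall x,
    right_continuous (fun l => spectral_proj l x) ;
  spectral_projNy : forall x, spectral_proj l x @[l --> -oo] --> (0 : H) ;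
  spectral_projy : forall x, spectral_proj l x @[l --> +oo] --> x
}.

Section spectral_measure.
Context {R : realType} {H : hilbertType R}.
Variables (E : spectralFamily H) (h : H).

(* The values of [dot (E l h) h] are real. *)
Definition spectral_distribution (l : R) : R := complex.Re (dot (E l h) h).

Lemma dot_spectral_proj l : dot (E l h) h = `|E l h| ^+ 2.
Proof.
by rewrite sqr_norm_dot -spectral_proj_adj spectral_proj_comp minxx.
Qed.

Lemma spectral_distributionE l :
  (spectral_distribution l)%:C = dot (E l h) h.
Proof.
by rewrite /spectral_distribution dot_spectral_proj RRe_real.
Qed.

Lemma spectral_distribution_diff l m : l <= m ->
  (spectral_distribution m - spectral_distribution l)%:C =
  `|E m h - E l h| ^+ 2.
Proof.
move=> lm; rewrite rmorphB/= !spectral_distributionE sqr_norm_dot.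
rewrite !linearB/= !linearBl/= -!spectral_proj_adj !spectral_proj_comp !minxx.
by rewrite (min_r lm) (min_l lm) subrr subr0.
Qed.

Lemma spectral_distribution_nondecreasing : nondecreasing spectral_distribution.
Proof.
move=> l m lm; rewrite -subr_ge0 -lecR spectral_distribution_diff//.
by rewrite exprn_ge0.
Qed.

Lemma spectral_distribution_right_continuous :
  right_continuous spectral_distribution.
Proof.
move=> l; apply/cvgrPdist_lt => e e0.
have /cvgrPdist_lt Ec := @spectral_proj_right_continuous _ _ E h l.
have se0 : 0 < (Num.sqrt e)%:C by rewrite ltcR sqrtr_gt0.
have {}Ec := Ec _ se0; near=> m.
have lm : l <= m by near: m; exact: nbhs_right_ge.
rewrite distrC ger0_norm ?subr_ge0; last first.
  exact: spectral_distribution_nondecreasing.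
rewrite -ltcR spectral_distribution_diff// distrC.
have -> : e%:C = (Num.sqrt e)%:C ^+ 2.
  by rewrite -rmorphXn/= sqr_sqrtr// ltW.
by rewrite ltrXn2r//; near: m.
Unshelve. all: by end_near. Qed.

HB.instance Definition _ := isCumulative.Build R _ R spectral_distribution
  spectral_distribution_nondecreasing spectral_distribution_right_continuous.

Definition spectral_measure : {measure set (measurableTypeR R) -> \bar R} :=
  lebesgue_stieltjes_measure spectral_distribution.

End spectral_measure.

Definition complex_integral (R : realType)
    (mu : {measure set (measurableTypeR R) -> \bar R}) (phi : R -> R[i]) : R[i] :=
  (\int[mu]_l complex.Re (phi l))%R +i* (\int[mu]_l complex.Im (phi l))%R.

Lemma polarization (R : realType) (H : hilbertType R)
    (E : spectralFamily H) (f g : H) (l : R) :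
  dot (E l f) g = 4^-1 * \sum_(0 <= k < 4)
    'i%C ^+ k * (spectral_distribution E (f + 'i%C ^+ k *: g) l)%:C.
Proof.
have expand (z zc : R[i]) : conjc z = zc ->
    dot (E l (f + z *: g)) (f + z *: g) =
    dot (E l f) f + zc * dot (E l f) g + z * dot (E l g) f +
    z * zc * dot (E l g) g.
  move=> <-; rewrite [E l _]linearD [E l (_ *: _)]linearZ/= linearDl
    linearZl_LR/= !linearD/= !linearZr_LR/=.
  ring.
have i2 : 'i%C ^+ 2 = -1 :> R[i] := sqr_i R.
have ic k : conjc ('i%C ^+ k) = (- 'i%C) ^+ k :> R[i].
  rewrite [LHS]rmorphXn/=; congr (_ ^+ k).
  by apply/eqP; rewrite eq_complex /= oppr0 !eqxx.
under eq_bigr do rewrite spectral_distributionE (expand _ _ (ic _)).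
rewrite !big_nat_recl// big_geq//.
have i3 : 'i%C ^+ 3 = - 'i%C :> R[i] by rewrite exprS i2 mulrN1.
have i2c : (- 'i%C) ^+ 2 = - 1 :> R[i] by rewrite sqrrN i2.
have i3c : (- 'i%C) ^+ 3 = 'i%C :> R[i] by rewrite exprS i2c mulrN1 opprK.
rewrite !expr0 !expr1 i2 i3 i2c i3c.
apply: (@mulfI _ (4 : R[i])); first by rewrite pnatr_eq0.
rewrite mulVKf ?pnatr_eq0//.
have ii : 'i%C * 'i%C = -1 :> R[i] by rewrite -expr2.
move: (dot _ _) (dot _ _) (dot _ _) (dot _ _) => a b c d.
rewrite !(mulrDr, mul1r, mulr1, mulrN, mulNr, mulN1r, opprK, mulrA, ii, opprD).
ring.
Qed.

(* The Stieltjes integral of [phi] against the complex-valued function of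
   bounded variation l |-> dot (E l f) g, decomposed by [polarization]
   into the nondecreasing functions [spectral_distribution]. *)
Definition spectral_integral (R : realType) (H : hilbertType R)
    (E : spectralFamily H) (phi : R -> R[i]) (f g : H) : R[i] :=
  4^-1 * \sum_(0 <= k < 4)
    'i%C ^+ k * complex_integral (spectral_measure E (f + 'i%C ^+ k *: g)) phi.

Definition expi (R : realType) (x : R) : R[i] := cos x +i* sin x.

(* [E] is the spectral resolution of the self-adjoint operator B such that
   U t = exp (i t B): since exp (i t B) is the integral of exp (i t l) dE(l),
   this amounts to the weak spectral representation of [U]. *)
Definition is_spectral_resolution (R : realType) (H : hilbertType R)
    (U : R -> {linear H -> H}) (E : spectralFamily H) : Prop :=
  forall t f g,
    dot (U t f) g = spectral_integral E (fun l => expi (t * l)) f g.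

(* The zeros of [sin] are excluded since [x / 0 = 0] here, whereas the quotient
   is to be read as +oo there. *)
Definition rho (R : realType) (alpha : R) : R :=
  inf [set x `^ (2 - alpha) / sin x ^+ 2 | x in [set x | 0 < x /\ sin x != 0]].

(* Main.v *)
From HB Require Import structures.
Require Import Defs.
From mathcomp Require Import all_boot all_order all_algebra.
From mathcomp Require Import complex.
From mathcomp Require Import all_classical all_reals all_analysis.
From mathcomp Require Import measurable_realfun.
From mathcomp Require Import ring lra.
Set Implicit Arguments.
Unset Strict Implicit.
Unset Printing Implicit Defensive.
Import Order.TTheory GRing.Theory Num.Theory.
Import numFieldNormedType.Exports.
Local Open Scope classical_set_scope.
Local Open Scope ring_scope.
Local Open Scope complex_scope.

(** With [g = f - P f], [tau = t - s] and sigma the spectral measure of [g], both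
    implications come from one formula, [ergodic_mean_norm]:
      the squared norm of [ergodic_mean U t s f - P f] is the integral of
      [(sin x / x) ^+ 2] with [x = tau * l / 2] against sigma.

    The formula rests on [orbit_sum_isometry]: the squared norm of a finite real
    combination of vectors [U c g] is the squared L2(sigma) norm of the same
    combination of exponentials [exp (i c l)]. It is obtained from the spectral
    resolution by expanding the square. Through this isometry, Riemann sums of
    the orbit become Riemann sums of the exponentials, whose distance to the
    integral is controlled at every frequency by the mean value theorem
    ([trig_riemann_sum_close]); integrating the square of that error shows that
    the Riemann sums in the Hilbert space are Cauchy, hence that the integral
    exists ([orbit_Riemann_integrable]), and bounded convergence along uniform
    partitions gives its norm.

    Upper bound: the kernel is at most [c ^+ 2 / Num.max c `|l| ^+ 2] with
    [c = 2 / tau] ([trig_prim_sqr_le]), and a layer-cake argument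
    ([layer_cake_bound]) evaluates the integral of the latter from the growth of
    the masses sigma ]-y, y].

    Lower bound: for [x] in ]0, pi[ and [tau = 2 * x / delta], the kernel is at
    least [(sin x / x) ^+ 2] on ]-delta, delta] ([trig_prim_sqr_ge]), so that
    sigma ]-delta, delta] is at most [(x / sin x) ^+ 2 * B * tau `^ (- alpha)];
    the infimum over [x] is [rho alpha] up to the stated factor ([rho_ge]). *)

(** * Spectral measures *)

Lemma spectral_measure_oc (R : realType) (H : hilbertType R)
    (E : spectralFamily H) (h : H) (a b : R) : a <= b ->
  spectral_measure E h `]a, b]%classic =
  (spectral_distribution E h b - spectral_distribution E h a)%:E.
Proof.
move=> ab.
transitivity (wlength (spectral_distribution E h) `]a, b]%classic).
  by apply: measurable_mu_extE; exact: is_ocitv.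
by rewrite wlength_itv_bnd.
Qed.

(** [E l] is an orthogonal projection, so that the squared norm of [h] is the
    sum of those of [E l h] and of [h - E l h]. *)
Lemma spectral_distribution_le (R : realType) (H : hilbertType R)
    (E : spectralFamily H) (h : H) (l : R) :
  0 <= spectral_distribution E h l <= complex.Re (dot h h).
Proof.
have El : (spectral_distribution E h l)%:C = `|E l h| ^+ 2.
  by rewrite spectral_distributionE dot_spectral_proj.
have hh : (complex.Re (dot h h))%:C = `|h| ^+ 2.
  by rewrite -sqr_norm_dot RRe_real// ger0_real// exprn_ge0.
apply/andP; split; first by rewrite -lecR El exprn_ge0.
rewrite -subr_ge0 -lecR rmorphB/= hh El.
suff -> : `|h| ^+ 2 - `|E l h| ^+ 2 = `|h - E l h| ^+ 2 :> R[i].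
  by rewrite exprn_ge0.
rewrite !sqr_norm_dot !linearB/= !linearBl/= -!spectral_proj_adj.
by rewrite !spectral_proj_comp minxx subrr subr0.
Qed.

Lemma spectral_measureT (R : realType) (H : hilbertType R)
    (E : spectralFamily H) (h : H) :
  (spectral_measure E h setT <= (complex.Re (dot h h))%:E)%E.
Proof.
rewrite -(bigcup_itvT false false).
pose I n : set (measurableTypeR R) := `]- (n%:R), n%:R]%classic.
have : (spectral_measure E h \o I) n @[n --> \oo] -->
    spectral_measure E h (\bigcup_n I n).
  apply: (@nondecreasing_cvg_mu _ _ _ (spectral_measure E h) I); rewrite /I//.
  - by apply: bigcup_measurable => n _; exact: (measurable_itv `]_, _]).
  - by move=> *; apply/subsetPset/subset_itv; rewrite leBSide/= ?lerN2 ler_nat.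
move=> c; rewrite -(cvg_lim _ c)//; apply: lime_le; first exact: cvgP c.
apply: nearW => n; rewrite /= spectral_measure_oc ?ge0_cp// lee_fin.
have /andP[a1 _] := spectral_distribution_le E h (- n%:R).
have /andP[_ b2] := spectral_distribution_le E h (n%:R).
lra.
Qed.

(** The finite-measure structure is attached to a named set function: an
    instance keyed on the projection of a bundled measure would not be found
    by unification. *)
Definition spectral_mass (R : realType) (H : hilbertType R)
  (E : spectralFamily H) (h : H) : set (measurableTypeR R) -> \bar R :=
  spectral_measure E h.

HB.instance Definition _ (R : realType) (H : hilbertType R)
    (E : spectralFamily H) (h : H) :=
  @isMeasure.Build _ _ _ (spectral_mass E h)
    (@measure0 _ _ _ (spectral_measure E h))
    (@measure_ge0 _ _ _ (spectral_measure E h))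
    (@measure_semi_sigma_additive _ _ _ (spectral_measure E h)).

Lemma spectral_mass_fin_num (R : realType) (H : hilbertType R)
    (E : spectralFamily H) (h : H) : fin_num_fun (spectral_mass E h).
Proof.
apply: lty_fin_num_fun.
exact: (le_lt_trans (spectral_measureT E h) (ltry _)).
Qed.

HB.instance Definition _ (R : realType) (H : hilbertType R)
    (E : spectralFamily H) (h : H) :=
  @Measure_isFinite.Build _ _ _ (spectral_mass E h)
    (@spectral_mass_fin_num R H E h).

(** Needed because the complex spectral integral is defined by polarization,
    that is, from the spectral measures of multiples of [h] when both arguments
    of the form are [h]. *)
Lemma spectral_measureZ (R : realType) (H : hilbertType R)
    (E : spectralFamily H) (z : R[i]) (h : H) (r : {nonneg R}) :
  z * z^* = r%:num%:C -> forall A, measurable A ->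
  spectral_measure E (z *: h) A = mscale r (spectral_measure E h) A.
Proof.
move=> zr A mA.
apply: lebesgue_stieltjes_measure_unique => // _ [[a b] _ <-].
have d l : spectral_distribution E (z *: h) l
    = r%:num * spectral_distribution E h l.
  apply: (@complexI R); rewrite rmorphM/= !spectral_distributionE -zr.
  by rewrite [E l _]linearZ linearZl_LR/= linearZr_LR/= mulrA.
have [ab|ba] := leP a b; last first.
  rewrite set_itv_ge ?bnd_simp -?leNgt ?ltW//.
  by rewrite !measure0.
by rewrite [LHS]spectral_measure_oc// [RHS]/= /mscale spectral_measure_oc// !d -mulrBr.
Qed.

Lemma Rintegral_mscale d (T : measurableType d) (R : realType)
    (mu : {measure set T -> \bar R}) (r : {nonneg R}) (f : T -> R) :
  mu.-integrable setT (fun x => (f x)%:E) ->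
  \int[mscale r mu]_x f x = r%:num * \int[mu]_x f x.
Proof.
move=> fi; rewrite /Rintegral integralE.
have mf := measurable_int mu fi.
rewrite !ge0_integral_mscale//; last 2 first.
- exact: measurable_funeneg.
- exact: measurable_funepos.
rewrite -muleBr//; last by rewrite fin_num_adde_defr// integrable_pos_fin_num.
by rewrite -[X in (_ * X)%E]integralE fineM// integrable_fin_num.
Qed.

Lemma complex_integral_spectral_measureZ (R : realType) (H : hilbertType R)
    (E : spectralFamily H) (g : H) (z : R[i]) (r : {nonneg R}) (phi : R -> R[i]) :
  z * z^* = r%:num%:C ->
  (spectral_measure E g).-integrable setT (fun x => (complex.Re (phi x))%:E) ->
  (spectral_measure E g).-integrable setT (fun x => (complex.Im (phi x))%:E) ->
  complex_integral (spectral_measure E (z *: g)) phi =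
  r%:num%:C * complex_integral (spectral_measure E g) phi.
Proof.
move=> zr iRe iIm.
have eqI (f : R -> R) :
    (spectral_measure E g).-integrable setT (fun x => (f x)%:E) ->
    \int[spectral_measure E (z *: g)]_x f x =
    r%:num * \int[spectral_measure E g]_x f x.
  move=> fi; rewrite -Rintegral_mscale//; congr fine.
  by apply: eq_measure_integral => A mA _; exact: spectral_measureZ.
rewrite /complex_integral !eqI//.
by apply/eqP; rewrite eq_complex /= !mul0r addr0 subr0 !eqxx.
Qed.

(** On the diagonal the four vectors of the polarization identity are
    [(1 + 'i ^ k) *: g], with squared moduli 4, 2, 0, 2; the two terms with
    coefficients ['i] and [- 'i] cancel. *)
Lemma spectral_integral_diag (R : realType) (H : hilbertType R)
    (E : spectralFamily H) (g : H) (phi : R -> R[i]) :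
  (spectral_measure E g).-integrable setT (fun x => (complex.Re (phi x))%:E) ->
  (spectral_measure E g).-integrable setT (fun x => (complex.Im (phi x))%:E) ->
  spectral_integral E phi g g = complex_integral (spectral_measure E g) phi.
Proof.
move=> iRe iIm; rewrite /spectral_integral.
set I := complex_integral _ _.
have i2 : 'i%C * 'i%C = -1 :> R[i] by rewrite -expr2 sqr_i.
have ci : ('i%C : R[i])^* = - 'i%C.
  by apply/eqP; rewrite eq_complex /= oppr0 !eqxx.
have cN : (- 'i%C : R[i])^* = 'i%C.
  by apply/eqP; rewrite eq_complex /= !oppr0 opprK !eqxx.
have c1 : (1 : R[i])^* = 1.
  by apply/eqP; rewrite eq_complex /= oppr0 !eqxx.
have cN1 : (-1 : R[i])^* = -1.
  by apply/eqP; rewrite eq_complex /= !oppr0 !eqxx.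
have cD (z : R[i]) : (1 + z)^* = 1 + z^*.
  by case: z => a b; apply/eqP; rewrite eq_complex /= opprD oppr0 !eqxx.
have term (z zc : R[i]) (n : nat) : z^* = zc -> (1 + z) * (1 + zc) = n%:R ->
    complex_integral (spectral_measure E (g + z *: g)) phi = n%:R * I.
  move=> <- zn; rewrite -[X in X + _]scale1r -scalerDl.
  rewrite (@complex_integral_spectral_measureZ _ _ _ _ _ (n%:R)%:nng)//=.
    by rewrite rmorph_nat.
  transitivity ((1 + z) * (1 + z^*)); last by rewrite zn rmorph_nat.
  by congr (_ * _); exact: cD.
rewrite !big_nat_recl// big_geq// !expr0 !expr1 exprS expr1 i2.
rewrite [X in 'i%C ^+ X]/= exprSr expr2 i2 !mulN1r.
rewrite (term _ _ 4 c1) ?(term _ _ 2 ci) ?(term _ _ 0 cN1) ?(term _ _ 2 cN).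
- apply: (@mulfI _ (4 : R[i])); first by rewrite pnatr_eq0.
  rewrite mulVKf ?pnatr_eq0//; ring.
- transitivity (1 - 'i%C * 'i%C : R[i]); first by ring.
  by rewrite i2 opprK.
- by rewrite subrr mul0r.
- transitivity (1 - 'i%C * 'i%C : R[i]); first by ring.
  by rewrite i2 opprK.
- ring.
Qed.

(** * The isometry with trigonometric sums *)

Lemma bounded_continuous_integrable (R : realType)
    (mu : {finite_measure set (measurableTypeR R) -> \bar R}) (f : R -> R) (M : R) :
  continuous f -> (forall x, `|f x| <= M) ->
  mu.-integrable setT (fun x => (f x)%:E).
Proof.
move=> cf fM; apply: (@measurable_bounded_integrable _ _ _ mu f setT) => //.
- exact: fin_num_fun_lty (@fin_num_measure _ _ _ mu).
- exact: continuous_measurable_fun.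
- exists M; split; first exact: num_real.
  by move=> N MN x _; apply: le_trans (fM x) _; exact: ltW.
Qed.

Lemma Rintegral_lin_sum d (T : measurableType d) (R : realType)
    (mu : {measure set T -> \bar R}) (I : Type) (r : seq I) (a : I -> R)
    (f : I -> T -> R) :
  (forall i, mu.-integrable setT (fun x => (f i x)%:E)) ->
  \int[mu]_x (\sum_(i <- r) a i * f i x) = \sum_(i <- r) a i * \int[mu]_x f i x.
Proof.
move=> fi; rewrite /Rintegral.
transitivity (fine (\int[mu]_x \sum_(i <- r) (a i * f i x)%:E)).
  by congr fine; apply: eq_integral => x _; rewrite sumEFin.
have afi i : mu.-integrable setT (fun x => (a i * f i x)%:E).
  by under eq_fun do rewrite EFinM; exact: integrableZl.
rewrite integral_sum// -sum_fine; last first.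
  by move=> i _; apply: integrable_fin_num.
apply: eq_bigr => i _; rewrite -[RHS]/(a i * Rintegral mu setT (f i)).
by rewrite -RintegralZl//; exact: fi.
Qed.

Lemma continuous_cosM (R : realType) (c : R) : continuous (fun x => cos (c * x)).
Proof.
move=> x; apply: continuous_comp; last exact: continuous_cos.
by apply: continuousM => //; exact: cst_continuous.
Qed.

Lemma continuous_sinM (R : realType) (c : R) : continuous (fun x => sin (c * x)).
Proof.
move=> x; apply: continuous_comp; last exact: continuous_sin.
by apply: continuousM => //; exact: cst_continuous.
Qed.

Lemma integrable_cosM (R : realType)
    (mu : {finite_measure set (measurableTypeR R) -> \bar R}) (c : R) :
  mu.-integrable setT (fun x => (cos (c * x))%:E).
Proof.
apply: (@bounded_continuous_integrable _ mu _ 1); first exact: continuous_cosM.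
by move=> x; exact: cos_max.
Qed.

Lemma integrable_sinM (R : realType)
    (mu : {finite_measure set (measurableTypeR R) -> \bar R}) (c : R) :
  mu.-integrable setT (fun x => (sin (c * x))%:E).
Proof.
apply: (@bounded_continuous_integrable _ mu _ 1); first exact: continuous_sinM.
by move=> x; exact: sin_max.
Qed.

(** A list of pairs (weight, time) encodes a finite linear combination of
    vectors of the orbit of [g]; under the spectral representation it becomes
    the trigonometric sum with real part [cos_sum] and imaginary part
    [sin_sum]. *)
Definition orbit_sum (R : realType) (H : hilbertType R) (U : R -> {linear H -> H})
  (g : H) (r : seq (R * R)) : H := \sum_(x <- r) x.1%:C *: U x.2 g.

Definition cos_sum (R : realType) (r : seq (R * R)) (l : R) : R :=
  \sum_(x <- r) x.1 * cos (x.2 * l).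

Definition sin_sum (R : realType) (r : seq (R * R)) (l : R) : R :=
  \sum_(x <- r) x.1 * sin (x.2 * l).

Lemma trig_sum_sqr (R : realType) (r : seq (R * R)) (l : R) :
  cos_sum r l ^+ 2 + sin_sum r l ^+ 2 =
  \sum_(x <- r) x.1 * \sum_(y <- r) y.1 * cos ((x.2 - y.2) * l).
Proof.
rewrite !expr2 /cos_sum /sin_sum !big_distrl/= -big_split/=.
apply: eq_bigr => x _; rewrite !big_distrr/= -big_split/=.
apply: eq_bigr => y _; rewrite mulrBl cosB; ring.
Qed.

Lemma trig_sum_sqr_integrable (R : realType)
    (mu : {finite_measure set (measurableTypeR R) -> \bar R}) (r : seq (R * R)) :
  mu.-integrable setT (fun l => (cos_sum r l ^+ 2 + sin_sum r l ^+ 2)%:E).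
Proof.
have icos c := integrable_cosM mu c.
under eq_fun do rewrite trig_sum_sqr -sumEFin.
apply: integrable_sum => // x _.
under eq_fun do rewrite EFinM -sumEFin.
apply: integrableZl => //; apply: integrable_sum => // y _.
by under eq_fun do rewrite EFinM; exact: integrableZl.
Qed.

(** Expanding the square yields the inner products of [U s g] and [U t g],
    which by unitarity depend only on [s - t] and are Fourier coefficients of
    the spectral measure. Only their real parts matter, since the weights are
    real and the total is real. *)
Lemma orbit_sum_isometry (R : realType) (H : hilbertType R)
    (U : R -> {linear H -> H}) (hU : is_unitary_group U)
    (E : spectralFamily H) (hE : is_spectral_resolution U E)
    (g : H) (r : seq (R * R)) :
  `|orbit_sum U g r| ^+ 2 =
  (\int[spectral_mass E g]_l (cos_sum r l ^+ 2 + sin_sum r l ^+ 2))%:C.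
Proof.
set mu := spectral_mass E g.
have icos c := integrable_cosM mu c.
have isin c := integrable_sinM mu c.
have UU s t : complex.Re (dot (U s g) (U t g)) = \int[mu]_x cos ((s - t) * x).
  have -> : U s g = U t (U (s - t) g).
    by rewrite -(unitary_groupD hU) addrC subrK.
  rewrite (unitary_group_dot hU) hE spectral_integral_diag//=.
have ReD : {morph @complex.Re R : x y / x + y >-> x + y} by case=> ? ? [].
rewrite -[LHS]RRe_real; last by rewrite ger0_real// exprn_ge0.
congr (_%:C).
under [RHS]eq_Rintegral do rewrite trig_sum_sqr.
rewrite sqr_norm_dot /orbit_sum linear_sumlz/= (big_morph _ ReD erefl).
rewrite Rintegral_lin_sum; last first.
  move=> x; under eq_fun do rewrite -sumEFin.
  apply: integrable_sum => // y _; under eq_fun do rewrite EFinM.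
  exact: integrableZl.
apply: eq_bigr => x _; rewrite Rintegral_lin_sum//.
rewrite linear_sumr/= (big_morph _ ReD erefl) big_distrr/=.
apply: eq_bigr => y _; rewrite linearZl_LR linearZr_LR/= -UU.
case: (dot _ _) => a b /=; ring.
Qed.

(** * Riemann sums of oscillating functions *)

(** The tagged partitions of the definition of the Riemann integral, with a
    non-strict bound on the mesh. *)
Definition tagged_partition (R : realType) (a b d : R) (n : nat) (p c : nat -> R) :=
  [/\ p 0%N = a, p n = b & forall i, (i < n)%N ->
    [/\ p i <= c i, c i <= p i.+1 & p i.+1 - p i <= d]].

Definition partition_nodes (R : realType) (n : nat) (p c : nat -> R) : seq (R * R) :=
  [seq (p i.+1 - p i, c i) | i <- index_iota 0 n].

(** Allowing [a = b] spares case distinctions on degenerate intervals of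
    partitions. *)
Lemma mvt_all (R : realType) (G g : R -> R) (a b : R) : a <= b ->
  (forall x : R, is_derive x 1 G (g x)) ->
  exists2 c, a <= c <= b & G b - G a = g c * (b - a).
Proof.
move=> ab dG.
have [|c cab Gc] := @MVT_segment R G g a b ab.
- by apply: derivable_within_continuous => x _; case: (dG x).
- by exists c.
Qed.

Lemma derive_lipschitz (R : realType) (G g : R -> R) (L : R) :
  (forall x : R, is_derive x 1 G (g x)) -> (forall x, `|g x| <= L) ->
  forall x y, `|G x - G y| <= L * `|x - y|.
Proof.
move=> dG gL x y; wlog yx : x y / y <= x => [wl|].
  have [|/ltW] := leP y x; first exact: wl.
  by rewrite (distrC (G x)) (distrC x); exact: wl.
have [c _ ->] := mvt_all yx dG.
by rewrite normrM ler_wpM2r.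
Qed.

(** On each interval the mean value theorem turns the increment of [G] into a
    value of [g] at a point within [d] of the tag; no refinement of partitions
    is involved. *)
Lemma riemann_sum_error (R : realType) (G g : R -> R) (L a b d : R) n p c :
  (forall x : R, is_derive x 1 G (g x)) ->
  (forall x y, `|g x - g y| <= L * `|x - y|) -> 0 <= L ->
  tagged_partition a b d n p c ->
  `|\sum_(0 <= i < n) (p i.+1 - p i) * g (c i) - (G b - G a)| <=
  (b - a) * (L * d).
Proof.
move=> dG gL L0 [<- <-]; elim: n => [|n IH] pc.
  by rewrite big_geq// !subrr mul0r normr0.
have {}IH := IH (fun i ni => pc i (ltnW ni)).
have [pc1 cp1 mesh] := pc n (ltnSn n).
have pp : p n <= p n.+1 by exact: le_trans cp1.
have [x /andP[px xp] Gx] := mvt_all pp dG.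
rewrite big_nat_recr//=.
rewrite (_ : _ - _ = (\sum_(0 <= i < n) (p i.+1 - p i) * g (c i) - (G (p n) - G (p 0%N)))
   + (p n.+1 - p n) * (g (c n) - g x)); last first.
  rewrite mulrBr [_ * g x]mulrC -Gx; ring.
rewrite (le_trans (ler_normD _ _))//.
rewrite (_ : _ * (L * d) = (p n - p 0%N) * (L * d) + (p n.+1 - p n) * (L * d)); last by ring.
rewrite lerD// normrM ger0_norm ?subr_ge0// ler_wpM2l ?subr_ge0//.
rewrite (le_trans (gL _ _))// ler_wpM2l// (le_trans _ mesh)//.
rewrite ler_norml; apply/andP; split; lra.
Qed.

Lemma riemann_sum_bound (R : realType) (g : R -> R) (a b d : R) n p c :
  (forall x, `|g x| <= 1) -> tagged_partition a b d n p c ->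
  `|\sum_(0 <= i < n) (p i.+1 - p i) * g (c i)| <= b - a.
Proof.
move=> g1 [<- <-]; elim: n => [|n IH] pc.
  by rewrite big_geq// !subrr normr0.
have {}IH := IH (fun i ni => pc i (ltnW ni)).
have [pc1 cp1 mesh] := pc n (ltnSn n).
have pp : p n <= p n.+1 by exact: le_trans cp1.
rewrite big_nat_recr//= (le_trans (ler_normD _ _))//.
rewrite (_ : p n.+1 - p 0%N = (p n - p 0%N) + (p n.+1 - p n)); last by ring.
by rewrite lerD// normrM ger0_norm ?subr_ge0// ler_piMr// subr_ge0.
Qed.

(** Antiderivatives of [x |-> cos (x * l)] and [x |-> sin (x * l)] that also
    cover the frequency 0. *)
Definition cos_prim (R : realType) (l x : R) : R :=
  if l == 0 then x else sin (x * l) / l.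

Definition sin_prim (R : realType) (l x : R) : R :=
  if l == 0 then 0 else - (cos (x * l) / l).

Lemma is_derive_mulr (R : realType) (l x : R) :
  is_derive x 1 (fun y : R => y * l) l.
Proof.
have := @is_deriveM R R^o id (cst l) x 1 _ _ (is_derive_id _ _) (is_derive_cst _ _ _).
by rewrite /= scaler0 add0r [l *: _]mulr1.
Qed.

Lemma is_derive_sinM (R : realType) (l x : R) :
  is_derive x 1 (fun y : R => sin (y * l)) (cos (x * l) * l).
Proof. exact: (@is_derive1_comp _ (@sin R) (fun y => y * l) x _ _ (is_derive_sin _) (is_derive_mulr l x)). Qed.

Lemma is_derive_cosM (R : realType) (l x : R) :
  is_derive x 1 (fun y : R => cos (y * l)) (- sin (x * l) * l).
Proof. exact: (@is_derive1_comp _ (@cos R) (fun y => y * l) x _ _ (is_derive_cos _) (is_derive_mulr l x)). Qed.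

Lemma is_derive_cos_prim (R : realType) (l x : R) :
  is_derive x 1 (cos_prim l) (cos (x * l)).
Proof.
rewrite /cos_prim; have [->|l0] := eqVneq l 0.
  by rewrite mulr0 cos0; exact: is_derive_id.
have := @is_derive1_comp _ (fun y => y * l^-1) (fun y => sin (y * l)) x _ _
  (is_derive_mulr _ _) (is_derive_sinM l x).
by rewrite mulrCA mulVf// mulr1.
Qed.

Lemma is_derive_sin_prim (R : realType) (l x : R) :
  is_derive x 1 (sin_prim l) (sin (x * l)).
Proof.
rewrite /sin_prim; have [->|l0] := eqVneq l 0.
  by rewrite mulr0 sin0; exact: is_derive_cst.
have := @is_derive1_comp _ (fun y => y * - l^-1) (fun y => cos (y * l)) x _ _
  (is_derive_mulr _ _) (is_derive_cosM l x).
rewrite mulrCA !mulNr mulVf// mulrN1 opprK.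
rewrite (_ : _ \o _ = fun y => - (cos (y * l) / l))//.
by apply/funext => y /=; rewrite mulrN.
Qed.

Lemma cos_lipschitz (R : realType) (l x y : R) :
  `|cos (x * l) - cos (y * l)| <= `|l| * `|x - y|.
Proof.
apply: (derive_lipschitz (is_derive_cosM l)) => {}x.
by rewrite normrM normrN ler_piMl// sin_max.
Qed.

Lemma sin_lipschitz (R : realType) (l x y : R) :
  `|sin (x * l) - sin (y * l)| <= `|l| * `|x - y|.
Proof.
apply: (derive_lipschitz (is_derive_sinM l)) => {}x.
by rewrite normrM ler_piMl// cos_max.
Qed.

Lemma bounded_cvg_Rintegral d (T : measurableType d) (R : realType)
    (mu : {finite_measure set T -> \bar R}) (f_ : nat -> T -> R) (f : T -> R) (M : R) :
  (forall n, measurable_fun setT (f_ n)) ->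
  (forall n x, `|f_ n x| <= M) ->
  (forall x, f_ n x @[n --> \oo] --> f x) ->
  mu.-integrable setT (fun x => (f x)%:E) /\
  \int[mu]_x f_ n x @[n --> \oo] --> \int[mu]_x f x.
Proof.
move=> mf_ f_M f_f.
have mf_E n : measurable_fun setT (fun x => (f_ n x)%:E) by exact/measurable_EFinP.
have iM : mu.-integrable setT (EFin \o cst M) by exact: finite_measure_integrable_cst.
have f_fE x : setT x -> (f_ n x)%:E @[n --> \oo] --> (f x)%:E.
  by move=> _; apply: cvg_EFin; [exact: nearW|exact: f_f].
have f_ME n x : setT x -> (`|(f_ n x)%:E| <= (EFin \o cst M) x)%E.
  by move=> _; rewrite /= lee_fin.
have mf : measurable_fun setT (fun x => (f x)%:E).
  exact: emeasurable_fun_cvg mf_E f_fE.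
have [||fi _ c] := dominated_convergence measurableT mf_E mf _ iM.
- exact: aeW.
- by apply: aeW => x n; exact: f_ME.
split => //; apply: fine_cvg; rewrite fineK//; exact: integrable_fin_num.
Qed.

(** Up to a factor [2 * (b - a)], this bounds the error of a Riemann sum of
    mesh [d] for an oscillation of frequency [l]: the Lipschitz bound is useful
    for small [l], the trivial one for large [l]. The cap at 1 makes its square
    integrable against every finite measure, with an integral that vanishes
    with [d]. *)
Definition capped (R : realType) (d l : R) : R := Num.min 1 (`|l| * d).

Lemma capped_le1 (R : realType) (d l : R) : 0 <= d -> 0 <= capped d l <= 1.
Proof.
by move=> d0; rewrite /capped le_min ler01 mulr_ge0//= ge_min lexx.
Qed.

Lemma measurable_capped_sqr (R : realType) (d : R) :
  measurable_fun setT (fun l => capped d l ^+ 2).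
Proof.
apply: measurable_funX; apply: measurable_minr; first exact: measurable_cst.
by apply: measurable_funM; [exact: normr_measurable|exact: measurable_cst].
Qed.

Lemma capped_integral_small (R : realType)
    (mu : {finite_measure set (measurableTypeR R) -> \bar R}) (K e : R) :
  0 < e -> exists2 d, 0 < d & K * \int[mu]_l (capped d l ^+ 2) < e.
Proof.
move=> e0.
have h0 n : 0 <= n.+1%:R^-1 :> R by rewrite invr_ge0.
have [||l|_ c] := @bounded_cvg_Rintegral _ _ _ mu
    (fun n l => capped (n.+1%:R^-1) l ^+ 2) (cst 0) 1.
- by move=> n; exact: measurable_capped_sqr.
- move=> n l; have /andP[c0 c1] := capped_le1 l (h0 n).
  by rewrite ger0_norm ?sqr_ge0// expr_le1.
- apply: (@squeeze_cvgr _ _ _ _ (cst 0) (fun n => `|l| * n.+1%:R^-1)).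
  + apply: nearW => n; rewrite sqr_ge0/=.
    have /andP[c0 c1] := capped_le1 l (h0 n).
    by rewrite expr2 (le_trans (ler_piMl c0 c1))// /capped ge_min lexx orbT.
  + exact: cvg_cst.
  + by rewrite -(mulr0 `|l|); apply: cvgMl_tmp; exact: cvg_harmonic.
have {}c : K * \int[mu]_l capped n.+1%:R^-1 l ^+ 2 @[n --> \oo] --> 0.
  have -> : 0 = K * \int[mu]_l (cst 0 l).
    by rewrite /Rintegral integral0 mulr0.
  exact: cvgMl_tmp.
move: c => /cvgr_lt/(_ _ e0) [N _ /(_ N (leqnn _)) /= small].
by exists N.+1%:R^-1; rewrite ?invr_gt0.
Qed.

Lemma nodes_sumE (R : realType) (V : nmodType) (F : R * R -> V) n (p c : nat -> R) :
  \sum_(x <- partition_nodes n p c) F x =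
  \sum_(0 <= i < n) F (p i.+1 - p i, c i).
Proof. by rewrite big_map. Qed.

Lemma prim_bound (R : realType) (G g : R -> R) (a b : R) : a <= b ->
  (forall x : R, is_derive x 1 G (g x)) -> (forall x, `|g x| <= 1) ->
  `|G b - G a| <= b - a.
Proof.
move=> ab dG g1; have := derive_lipschitz dG g1 b a.
by rewrite mul1r (ger0_norm (x := b - a))// subr_ge0.
Qed.

Lemma trig_riemann_sum_close (R : realType) (a b d l : R) n p c :
  0 <= d -> a <= b -> tagged_partition a b d n p c ->
  let r := partition_nodes n p c in
  `|cos_sum r l - (cos_prim l b - cos_prim l a)| <= 2 * (b - a) * capped d l /\
  `|sin_sum r l - (sin_prim l b - sin_prim l a)| <= 2 * (b - a) * capped d l.
Proof.
move=> d0 ab pc /=; rewrite /cos_sum /sin_sum !nodes_sumE /=.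
have ba0 : 0 <= b - a by rewrite subr_ge0.
have cap (G g : R -> R) : (forall x : R, is_derive x 1 G (g x)) ->
    (forall x, `|g x| <= 1) ->
    (forall x y, `|g x - g y| <= `|l| * `|x - y|) ->
    `|\sum_(0 <= i < n) (p i.+1 - p i) * g (c i) - (G b - G a)| <=
    2 * (b - a) * capped d l.
  move=> dG g1 gL; rewrite /capped minr_pMr ?mulr_ge0// le_min mulr1.
  apply/andP; split.
    rewrite (le_trans (ler_normB _ _))// mulr_natl mulr2n.
    by rewrite lerD ?(riemann_sum_bound g1 pc)// prim_bound.
  rewrite (le_trans (riemann_sum_error dG gL _ pc))// -mulrA ler_peMl ?ler1n//.
  by rewrite !mulr_ge0.
split.
- apply: (cap (cos_prim l) (fun x => cos (x * l)) (is_derive_cos_prim l)).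
    by move=> x; exact: cos_max.
  by move=> x y; exact: cos_lipschitz.
- apply: (cap (sin_prim l) (fun x => sin (x * l)) (is_derive_sin_prim l)).
    by move=> x; exact: sin_max.
  by move=> x y; exact: sin_lipschitz.
Qed.

(** * The ergodic mean in spectral form *)

Definition uniform_nodes (R : realType) (a b : R) (n i : nat) : R :=
  a + (b - a) * (i%:R / n.+1%:R).

Lemma uniform_nodes_partition (R : realType) (a b : R) n : a <= b ->
  tagged_partition a b ((b - a) / n.+1%:R) n.+1 (uniform_nodes a b n) (uniform_nodes a b n).
Proof.
move=> ab; rewrite /uniform_nodes; split.
- by rewrite mul0r mulr0 addr0.
- by rewrite divff ?pnatr_eq0// mulr1 addrC subrK.
- move=> i _; rewrite lexx; split=> //.
    by rewrite lerD2l ler_wpM2l ?subr_ge0// ler_pM2r ?invr_gt0// ler_nat.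
  rewrite le_eqVlt -natr1; apply/orP; left; apply/eqP; ring.
Qed.

Lemma uniform_mesh_lt (R : realType) (a b d : R) : 0 < d ->
  \forall n \near \oo, (b - a) / n.+1%:R < d.
Proof.
move=> d0; have c : (b - a) / n.+1%:R @[n --> \oo] --> (0 : R).
  by rewrite -(mulr0 (b - a)); apply: cvgMl_tmp; exact: cvg_harmonic.
exact: cvgr_lt c _ d0.
Qed.

(** The squared modulus of the integral of [exp (i l x)] over [[a, b]]. *)
Definition trig_prim_sqr (R : realType) (a b l : R) : R :=
  (cos_prim l b - cos_prim l a) ^+ 2 + (sin_prim l b - sin_prim l a) ^+ 2.

Section orbit.
Context (R : realType) (H : hilbertType R) (U : R -> {linear H -> H}).
Hypothesis hU : is_unitary_group U.
Context (E : spectralFamily H).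
Hypothesis hE : is_spectral_resolution U E.

Lemma orbit_sumB (g : H) (r1 r2 : seq (R * R)) :
  let r := r1 ++ [seq (- x.1, x.2) | x <- r2] in
  [/\ orbit_sum U g r = orbit_sum U g r1 - orbit_sum U g r2,
      forall l, cos_sum r l = cos_sum r1 l - cos_sum r2 l &
      forall l, sin_sum r l = sin_sum r1 l - sin_sum r2 l].
Proof.
split=> [|l|l]; rewrite /orbit_sum /cos_sum /sin_sum big_cat big_map/= -sumrN.
- by congr (_ + _); apply: eq_bigr => x _; rewrite rmorphN scaleNr.
- by congr (_ + _); apply: eq_bigr => x _; rewrite mulNr.
- by congr (_ + _); apply: eq_bigr => x _; rewrite mulNr.
Qed.

(** By the isometry, the distance between two Riemann sums of the orbit is the
    L2 distance of the corresponding scalar Riemann sums, both of which are close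
    to the same integral. The constant is 2 * (2 * 2) ^ 2: two coordinates, two
    sums, and the factor 2 of the scalar estimate. *)
Lemma orbit_sum_close (g : H) (a b d : R) n1 p1 c1 n2 p2 c2 : 0 <= d -> a <= b ->
  tagged_partition a b d n1 p1 c1 -> tagged_partition a b d n2 p2 c2 ->
  `|orbit_sum U g (partition_nodes n1 p1 c1) -
    orbit_sum U g (partition_nodes n2 p2 c2)| ^+ 2 <=
  (32 * (b - a) ^+ 2 * \int[spectral_mass E g]_l (capped d l ^+ 2))%:C.
Proof.
move=> d0 ab pc1 pc2.
have [<- Ec Es] := orbit_sumB g (partition_nodes n1 p1 c1) (partition_nodes n2 p2 c2).
set r := _ ++ _ in Ec Es *.
rewrite (orbit_sum_isometry hU hE) lecR.
have icap : (spectral_mass E g).-integrable setT (fun l => (capped d l ^+ 2)%:E).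
  apply: (@measurable_bounded_integrable _ _ _ (spectral_mass E g) _ setT) => //.
  - exact: fin_num_fun_lty (@fin_num_measure _ _ _ (spectral_mass E g)).
  - exact: measurable_capped_sqr.
  - exists 1; split; first exact: num_real.
    move=> N N1 x _; apply: le_trans (ltW N1).
    have /andP[k0 k1] := capped_le1 x d0.
    by rewrite /= ger0_norm ?sqr_ge0// expr_le1.
rewrite -RintegralZl//; apply: le_Rintegral => //.
- exact: trig_sum_sqr_integrable.
- exact: (integrableZl measurableT _ icap).
move=> l _; rewrite Ec Es.
have [a1 b1] := trig_riemann_sum_close l d0 ab pc1.
have [a2 b2] := trig_riemann_sum_close l d0 ab pc2.
have /andP[k0 _] := capped_le1 l d0.
have ba0 : 0 <= b - a by rewrite subr_ge0.
have sq (x y z : R) : `|x - z| <= 2 * (b - a) * capped d l ->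
    `|y - z| <= 2 * (b - a) * capped d l ->
    (x - y) ^+ 2 <= 16 * (b - a) ^+ 2 * capped d l ^+ 2.
  move=> xz yz; have xy : `|x - y| <= 4 * (b - a) * capped d l.
    rewrite (_ : x - y = (x - z) - (y - z)); last by ring.
    rewrite (le_trans (ler_normB _ _))//; lra.
  rewrite (_ : 16 * _ * _ = (4 * (b - a) * capped d l) ^+ 2); last by ring.
  by rewrite -(real_normK (num_real (x - y))) lerXn2r// nnegrE ?normr_ge0// !mulr_ge0.
have := sq _ _ _ a1 a2; have := sq _ _ _ b1 b2; lra.
Qed.

Lemma sqr_norm_lt (x : H) (K e : R) : 0 < e -> `|x| ^+ 2 <= K%:C -> K < e ^+ 2 ->
  `|x| < e%:C.
Proof.
move=> e0 xK Ke; rewrite -(@ltr_pXn2r _ 2)// ?nnegrE ?lecR ?(ltW e0)//.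
by rewrite (le_lt_trans xK)// -rmorphXn/= ltcR.
Qed.

Definition uniform_sum (g : H) (a b : R) (n : nat) := orbit_sum U g
  (partition_nodes n.+1 (uniform_nodes a b n) (uniform_nodes a b n)).

(** The Riemann sums form a Cauchy family as the mesh tends to 0, and the
    space is complete. *)
Lemma orbit_Riemann_integrable (g : H) (a b : R) : a <= b ->
  exists v, is_Riemann_integral (fun tau => U tau g) a b v.
Proof.
move=> ab.
have close e : 0 < e -> exists2 d : R, 0 < d & forall n1 p1 c1 n2 p2 c2,
    tagged_partition a b d n1 p1 c1 -> tagged_partition a b d n2 p2 c2 ->
  `|orbit_sum U g (partition_nodes n1 p1 c1) -
    orbit_sum U g (partition_nodes n2 p2 c2)| < e%:C.
  move=> e0; have e20 : 0 < e ^+ 2 by rewrite exprn_gt0.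
  have [d d0 small] := capped_integral_small (spectral_mass E g)
    (32 * (b - a) ^+ 2) e20.
  exists d => // n1 p1 c1 n2 p2 c2 pc1 pc2; apply: sqr_norm_lt small => //.
  exact: orbit_sum_close (ltW d0) ab pc1 pc2.
have fine_uniform d : 0 < d -> \forall n \near \oo,
    tagged_partition a b d n.+1 (uniform_nodes a b n) (uniform_nodes a b n).
  move=> d0; apply: filterS (uniform_mesh_lt a b d0) => n nd.
  have [p0 pn pc] := uniform_nodes_partition n ab; split => // i /pc[? ? m].
  by split => //; rewrite (le_trans m)// ltW.
have : cauchy (uniform_sum g a b @ \oo).
  apply: cauchy_exP => e e0.
  have eR : e = (complex.Re e)%:C by rewrite RRe_real// gtr0_real.
  have {}e0 : 0 < complex.Re e by rewrite -ltcR -eR.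
  have [d d0 cl] := close _ e0; have [N _ fN] := fine_uniform _ d0.
  exists (uniform_sum g a b N); exists N => // n Nn.
  rewrite -ball_normE/= eR; by apply: cl; [exact: (fN N (leqnn N))|exact: (fN n Nn)].
move=> /cauchy_cvg/cvg_ex[v Tv]; exists v => e e0.
have [d d0 cl] := close (e / 2) (divr_gt0 e0 (ltr0n _ 2)).
exists d => // n p c p0 pn pc.
have e2 : 0 < (e / 2)%:C by rewrite ltcR divr_gt0.
have := fine_uniform _ d0; move/cvgrPdist_lt : Tv => /(_ _ e2) Tv du.
have [m [vm um]] := filter_ex (filterI Tv du).
have pc' : tagged_partition a b d n p c.
  by split => // i /pc[? ? /ltW].
have := cl _ _ _ _ _ _ pc' um => cl1.
have -> : \sum_(0 <= i < n) (p i.+1 - p i)%:C *: U (c i) g =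
    orbit_sum U g (partition_nodes n p c) by rewrite /orbit_sum nodes_sumE.
set S := orbit_sum _ _ _ in cl1 *.
rewrite (_ : S - v = (S - uniform_sum g a b m) - (v - uniform_sum g a b m)); last first.
  by rewrite opprB addrA subrK.
rewrite (le_lt_trans (ler_normB _ _))// (_ : e%:C = (e / 2)%:C + (e / 2)%:C).
  by rewrite ltrD.
by rewrite -rmorphD/= -splitr.
Qed.

Lemma Riemann_integral_uniform_cvg (g : H) (a b : R) (v : H) : a <= b ->
  is_Riemann_integral (fun tau => U tau g) a b v ->
  uniform_sum g a b n @[n --> \oo] --> v.
Proof.
move=> ab gv; apply/cvgrPdist_lt => e e0.
have eR : e = (complex.Re e)%:C by rewrite RRe_real// gtr0_real.
have {}e0 : 0 < complex.Re e by rewrite -ltcR -eR.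
have [d d0 dv] := gv _ e0.
apply: filterS (uniform_mesh_lt a b d0) => n nd.
have [p0 pn pc] := uniform_nodes_partition n ab.
rewrite distrC eR /uniform_sum /orbit_sum nodes_sumE; apply: dv => // i /pc[? ? m].
by split=> //; exact: le_lt_trans nd.
Qed.

Lemma trig_prim_sqr_bounded_cvg (a b : R) (f_ := fun n l =>
    let r := partition_nodes n.+1 (uniform_nodes a b n) (uniform_nodes a b n) in
    cos_sum r l ^+ 2 + sin_sum r l ^+ 2)
    (mu : {finite_measure set (measurableTypeR R) -> \bar R}) : a <= b ->
  mu.-integrable setT (fun l => (trig_prim_sqr a b l)%:E) /\
  \int[mu]_l f_ n l @[n --> \oo] --> \int[mu]_l trig_prim_sqr a b l.
Proof.
move=> ab; have ba0 : 0 <= b - a by rewrite subr_ge0.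
apply: (@bounded_cvg_Rintegral _ _ _ mu f_ _ (2 * (b - a) ^+ 2)).
- move=> n; apply/measurable_EFinP.
  exact: (measurable_int mu (trig_sum_sqr_integrable mu _)).
- move=> n l; rewrite ger0_norm ?addr_ge0 ?sqr_ge0// mulr_natl mulr2n.
  have pc := uniform_nodes_partition n ab.
  rewrite lerD//; rewrite -(real_normK (num_real (_ _ l))) lerXn2r// ?nnegrE//;
    rewrite /cos_sum /sin_sum nodes_sumE.
    by apply: (riemann_sum_bound _ pc (g := fun x => cos (x * l))) => x; exact: cos_max.
  by apply: (riemann_sum_bound _ pc (g := fun x => sin (x * l))) => x; exact: sin_max.
move=> l; have c0 : `|l| * ((b - a) / n.+1%:R) @[n --> \oo] --> (0 : R).
  rewrite -(mulr0 `|l|) -[X in _ * X](mulr0 (b - a)).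
  by apply: cvgMl_tmp; apply: cvgMl_tmp; exact: cvg_harmonic.
have {}c0 : 2 * (b - a) * capped ((b - a) / n.+1%:R) l @[n --> \oo] --> (0 : R).
  rewrite -(mulr0 (2 * (b - a))); apply: cvgMl_tmp.
  apply: (@squeeze_cvgr _ _ _ _ (cst 0) _ _ _ _ _ c0); last exact: cvg_cst.
  apply: nearW => n; have d0 : 0 <= (b - a) / n.+1%:R by rewrite divr_ge0.
  have /andP[-> _] := capped_le1 l d0.
  by rewrite /capped ge_min lexx orbT.
have close (x_ : nat -> R) (x : R) :
    (forall n, `|x_ n - x| <= 2 * (b - a) * capped ((b - a) / n.+1%:R) l) ->
    x_ n ^+ 2 @[n --> \oo] --> x ^+ 2.
  move=> xx; have : x_ n @[n --> \oo] --> x.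
    apply/cvgrPdist_lt => e e0.
    move/cvgrPdist_lt : (c0) => /(_ _ e0); apply: filterS => n.
    rewrite sub0r normrN distrC; apply: le_lt_trans.
    exact: le_trans (xx n) (ler_norm _).
  by move=> c; exact: (cvgM c c).
have d0 n : 0 <= (b - a) / n.+1%:R by rewrite divr_ge0.
apply: cvgD; apply: close => n.
  by have [] := trig_riemann_sum_close l (d0 n) ab (uniform_nodes_partition n ab).
by have [] := trig_riemann_sum_close l (d0 n) ab (uniform_nodes_partition n ab).
Qed.

Lemma uniform_sum_norm_lim (g : H) (a b : R) (w : H) : a <= b ->
  uniform_sum g a b n @[n --> \oo] --> w ->
  `|w| ^+ 2 = (\int[spectral_mass E g]_l trig_prim_sqr a b l)%:C.
Proof.
move=> ab cw.
have [_ cI] := trig_prim_sqr_bounded_cvg (spectral_mass E g) ab.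
have c1 : `|uniform_sum g a b n| ^+ 2 @[n --> \oo] --> `|w| ^+ 2.
  have c : `|uniform_sum g a b n| @[n --> \oo] --> `|w| by exact: cvg_norm.
  exact: (cvgM c c).
apply: (cvg_unique _ c1); first exact: norm_hausdorff.
apply/cvgrPdist_lt => e e0.
have eR : e = (complex.Re e)%:C by rewrite RRe_real// gtr0_real.
have {}e0 : 0 < complex.Re e by rewrite -ltcR -eR.
move/cvgrPdist_lt : cI => /(_ _ e0); apply: filterS => n In.
rewrite /uniform_sum (orbit_sum_isometry hU hE) -rmorphB/= eR.
by rewrite normc_def/= expr0n/= addr0 sqrtr_sqr ltcR.
Qed.

(** [P f] is fixed by the group, so that the Riemann sums of the orbit of [f]
    differ from those of the orbit of [f - P f] by [(t - s) *: P f] exactly. *)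
Lemma ergodic_mean_norm (P : H -> H)
    (hP : is_orthogonal_projection (fixed_vectors U) P) (f : H) (t s : R) : s < t ->
  `|ergodic_mean U t s f - P f| ^+ 2 =
  ((t - s) ^- 2 * \int[spectral_mass E (f - P f)]_l trig_prim_sqr s t l)%:C.
Proof.
move=> st; have [v fv] := orbit_Riemann_integrable f (ltW st).
have {fv v} := @xgetPex _ 0 [set v | is_Riemann_integral (fun tau => U tau f) s t v]
  (ex_intro _ v fv).
rewrite -/(Riemann_integral (fun tau => U tau f) s t) /ergodic_mean/=.
set v := Riemann_integral _ _ _ => fv.
have ts0 : t - s != 0 by rewrite subr_eq0 gt_eqF.
have UP tau : U tau (P f) = P f by have [] := hP f.
have -> : ((t - s)^-1)%:C *: v - P f = ((t - s)^-1)%:C *: (v - (t - s)%:C *: P f).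
  by rewrite scalerBr scalerA -rmorphM/= mulVf// scale1r.
rewrite normrZ exprMn (@uniform_sum_norm_lim (f - P f) s t (v - (t - s)%:C *: P f)).
- rewrite normc_def/= expr0n/= addr0 sqrtr_sqr -rmorphXn -rmorphM/= real_normK ?num_real//.
  by congr (_ * _)%:C; exact: exprVn.
- exact: ltW.
have -> : uniform_sum (f - P f) s t = fun n => uniform_sum f s t n - (t - s)%:C *: P f.
  apply/funext => n; rewrite /uniform_sum /orbit_sum !nodes_sumE.
  under eq_bigr do rewrite linearB/= UP scalerBr.
  rewrite sumrB -scaler_suml -rmorph_sum/= telescope_sumr//.
  by have [-> -> _] := uniform_nodes_partition n (ltW st).
apply: cvgB; last exact: cvg_cst.
exact: Riemann_integral_uniform_cvg (ltW st) fv.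
Qed.
End orbit.

(** * Bounds for the squared cardinal sine *)

Lemma trig_prim_sqr0 (R : realType) (a b : R) : trig_prim_sqr a b 0 = (b - a) ^+ 2.
Proof. by rewrite /trig_prim_sqr /cos_prim /sin_prim eqxx subrr expr0n addr0. Qed.

Lemma trig_prim_sqrE (R : realType) (a b l : R) : l != 0 ->
  trig_prim_sqr a b l = 4 * sin ((b - a) * l / 2) ^+ 2 / l ^+ 2.
Proof.
move=> l0; rewrite /trig_prim_sqr /cos_prim /sin_prim (negbTE l0).
set y := (b - a) * l / 2.
have cy : cos (b * l) * cos (a * l) + sin (b * l) * sin (a * l) = 1 - 2 * sin y ^+ 2.
  rewrite -cosB (_ : b * l - a * l = y *+ 2); last by rewrite /y mulr2n; lra.
  by rewrite cos_mulr2n cos2sin2 mulr2n; ring.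
have ca := cos2Dsin2 (a * l); have cb := cos2Dsin2 (b * l).
transitivity (((cos (b * l) ^+ 2 + sin (b * l) ^+ 2) + (cos (a * l) ^+ 2 + sin (a * l) ^+ 2)
  - 2 * (cos (b * l) * cos (a * l) + sin (b * l) * sin (a * l))) / l ^+ 2).
  by field.
by rewrite ca cb cy; congr (_ / _); ring.
Qed.

Lemma sin_le_norm (R : realType) (x : R) : `|sin x| <= `|x|.
Proof.
have := @derive_lipschitz R sin cos 1 (@is_derive_sin R) (@cos_max R) x 0.
by rewrite sin0 !subr0 mul1r.
Qed.

(** The squared cardinal sine is at most 1 and at most the inverse square of
    its argument [(b - a) * l / 2]. *)
Lemma trig_prim_sqr_le (R : realType) (a b l : R) : a < b ->
  trig_prim_sqr a b l / (b - a) ^+ 2 <=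
  (2 / (b - a)) ^+ 2 * (Num.max (2 / (b - a)) `|l|) ^- 2.
Proof.
move=> ab; have t0 : 0 < b - a by rewrite subr_gt0.
set t := b - a in t0 *; have c0 : 0 < 2 / t by rewrite divr_gt0.
rewrite /Num.max; case: ifPn => [cl|lc].
  have l0 : l != 0 by rewrite -normr_gt0 (lt_trans c0).
  rewrite trig_prim_sqrE// real_normK ?num_real//.
  rewrite (_ : 4 * _ / _ / _ = sin (t * l / 2) ^+ 2 * ((2 / t) ^+ 2 * l ^- 2)).
    apply: ler_piMl; first by rewrite mulr_ge0 ?invr_ge0 ?sqr_ge0.
    by rewrite -(real_normK (num_real (sin _))) expr_le1// sin_max.
  by field; rewrite l0 gt_eqF.
rewrite divff ?expf_neq0 ?gt_eqF// ler_pdivrMr ?exprn_gt0// mul1r.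
have [->|l0] := eqVneq l 0; first by rewrite trig_prim_sqr0.
rewrite trig_prim_sqrE// ler_pdivrMr ?exprn_even_gt0//.
rewrite (_ : 4 * _ = (2 * sin (t * l / 2)) ^+ 2); last by ring.
rewrite -exprMn -(real_normK (num_real (2 * _))) -[leRHS]real_normK ?num_real//.
rewrite lerXn2r ?nnegrE// normrM ger0_norm// mulrC -ler_pdivlMr//.
rewrite (le_trans (sin_le_norm _))// normrM (ger0_norm (x := 2^-1))// invr_ge0//.
Qed.

(** The chords of [sin] over [[0, u]] and [[u, x]] have slopes [cos c1] and
    [cos c2] with [c1 <= c2], and [cos] decreases on [[0, pi]]. *)
Lemma sin_div_decreasing (R : realType) (u x : R) : 0 < u -> u <= x -> x <= pi ->
  u * sin x <= x * sin u.
Proof.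
move=> u0 ux xpi.
have dS (y : R) : is_derive y 1 sin (cos y) by exact: is_derive_sin.
have [c1 /andP[c10 c1u]] := mvt_all (ltW u0) dS.
rewrite sin0 !subr0 => su.
have [c2 /andP[c2u c2x]] := mvt_all ux dS => sx.
have c12 : cos c2 <= cos c1.
  have c1c2 : c1 <= c2 by exact: le_trans c2u.
  have c2pi : c2 <= pi by exact: le_trans xpi.
  have c1pi : c1 <= pi by exact: le_trans c2pi.
  have c20 : 0 <= c2 by exact: le_trans c1c2.
  by rewrite leNgt ltr_cos -?leNgt// in_itv/= ?c10 ?c20.
have -> : sin x = sin u + cos c2 * (x - u) by rewrite -sx addrC subrK.
rewrite su -subr_ge0.
rewrite (_ : _ - _ = u * (x - u) * (cos c1 - cos c2)); last by ring.
by rewrite !mulr_ge0// ?subr_ge0// ltW.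
Qed.

(** As [sin u / u] decreases on [[0, pi]], over the frequencies [`|l| <= d] the
    squared cardinal sine is least at [l = d]. *)
Lemma trig_prim_sqr_ge (R : realType) (a b d l : R) : a < b -> 0 < d ->
  `|l| <= d -> (b - a) * d / 2 <= pi ->
  sin ((b - a) * d / 2) ^+ 2 / ((b - a) * d / 2) ^+ 2 <=
  trig_prim_sqr a b l / (b - a) ^+ 2.
Proof.
move=> ab d0 ld; have t0 : 0 < b - a by rewrite subr_gt0.
set t := b - a in t0 *; set x := t * d / 2 => xpi.
have x0 : 0 < x by rewrite /x !mulr_gt0.
rewrite ler_pdivrMr ?exprn_gt0//.
have [->|l0] := eqVneq l 0.
  rewrite trig_prim_sqr0 -/t divff ?expf_neq0 ?gt_eqF// mul1r.
  rewrite -(real_normK (num_real (sin x))) lerXn2r ?nnegrE ?(ltW x0)//.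
  by rewrite (le_trans (sin_le_norm x))// gtr0_norm.
rewrite trig_prim_sqrE// -/t.
have ln0 : 0 < `|l| by rewrite normr_gt0.
have -> : sin (t * l / 2) ^+ 2 = sin (t * `|l| / 2) ^+ 2.
  have [l1|l1] := leP 0 l; first by rewrite ger0_norm.
  by rewrite ltr0_norm// mulrN mulNr sinN sqrrN.
rewrite -(real_normK (num_real l)).
set u := t * `|l| / 2.
have u0 : 0 < u by rewrite /u !mulr_gt0.
have ux : u <= x by rewrite /u /x ler_pM2r// ler_pM2l.
have s := sin_div_decreasing u0 ux xpi.
rewrite (_ : 4 * _ / _ / _ = sin u ^+ 2 / u ^+ 2); last first.
  rewrite /u; field; rewrite ?gt_eqF//.
rewrite mulrAC ler_pdivlMr ?exprn_gt0//.
have sx0 : 0 <= sin x by rewrite sin_ge0_pi// xpi ltW.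
have su0 : 0 <= sin u by rewrite sin_ge0_pi// (ltW u0) (le_trans ux).
have su := mulr_ge0 sx0 (ltW u0); have us := mulr_ge0 su0 (ltW x0).
by rewrite -!exprMn lerXn2r// mulrC [leRHS]mulrC.
Qed.

(** * Integration over layers *)

Lemma is_derive_powR_tail (R : realType) (k x : R) : 0 < x ->
  is_derive x 1 (fun y : R => - y `^ (- k)) (k * x `^ (- k - 1)).
Proof.
move=> x0; have d : is_derive x 1 (fun y : R => y `^ (- k)) (- k * x `^ (- k - 1)).
  exact: is_derive1_powR.
by have := is_deriveN d; rewrite mulNr opprK.
Qed.

Lemma continuous_powR (R : realType) (k x : R) : 0 < x ->
  {for x, continuous (fun y : R => y `^ k)}.
Proof.
move=> x0; apply: differentiable_continuous; apply/derivable1_diffP.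
by case: (is_derive1_powR k x0).
Qed.

Lemma powR_tail_cvg0 (R : realType) (k : R) : 0 < k ->
  y `^ (- k) @[y --> +oo%R] --> (0 : R).
Proof.
move=> k0; apply/cvgrPdist_lt => e e0; near=> y.
have y0 : 0 < y by near: y; exact: nbhs_pinfty_gt.
rewrite sub0r normrN ger0_norm ?powR_ge0//.
have ey : e `^ (- k^-1) < y by near: y; apply: nbhs_pinfty_gt; exact: num_real.
rewrite powRN -(invrK e) ltf_pV2 ?posrE ?powR_gt0 ?invr_gt0//.
have -> : e^-1 = (e `^ (- k^-1)) `^ k.
  by rewrite -powRrM mulNr mulVf ?gt_eqF// powR_inv1// ltW.
by apply: gt0_ltr_powR => //; rewrite nnegrE ?powR_ge0 ?ltW.
Unshelve. all: by end_near. Qed.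

Lemma integral_powR_tail (R : realType) (b k : R) : 0 < b -> 0 < k ->
  (\int[@lebesgue_measure R]_(x in `[b, +oo[) (k * x `^ (- k - 1))%:E
    = (b `^ (- k))%:E)%E.
Proof.
move=> b0 k0.
rewrite (@ge0_continuous_FTC2y R _ (fun x => - x `^ (- k)) b 0).
- by rewrite sub0e -EFinN opprK.
- by move=> x _; rewrite mulr_ge0 ?powR_ge0// ltW.
- apply: continuous_in_subspaceT => x; rewrite inE/= in_itv/= andbT => bx.
  by apply: cvgMl_tmp; apply: continuous_powR; exact: lt_le_trans bx.
- rewrite -oppr0; apply: cvgN; exact: powR_tail_cvg0.
- move=> x bx; by case: (is_derive_powR_tail k (lt_trans b0 bx)).
- apply: cvg_at_right_filter; apply: cvgN; exact: continuous_powR.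
- move=> x; rewrite in_itv/= andbT => bx; rewrite derive1E.
  by case: (is_derive_powR_tail k (lt_trans b0 bx)).
Qed.

(** In the layer-cake argument, [S] is the set of layers above a frequency, which
    contains all those above [b]; the left-hand side is the total weight of the latter. *)
Lemma measurable_max_normN2 (R : realType) (c : R) : 0 < c ->
  measurable_fun setT (fun l : R => ((Num.max c `|l|) ^- 2)%:E).
Proof.
move=> c0; apply/measurable_EFinP.
rewrite (_ : (fun _ => _) = (fun x => x `^ (- 2%:R)) \o (fun l : R => Num.max c `|l|)).
  apply: measurableT_comp; first exact: measurable_powR.
  by apply: measurable_maxr; [exact: measurable_cst|exact: normr_measurable].
by apply/funext => l /=; rewrite powR_invn// le_max (ltW c0).
Qed.

Lemma tail_section_ge (R : realType) (b : R) (S : set R) : 0 < b ->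
  `]b, +oo[ `<=` S -> measurable S ->
  ((b ^- 2)%:E <= \int[@lebesgue_measure R]_x (2 * x `^ (- 2 - 1) * \1_S x)%:E)%E.
Proof.
move=> b0 bS mS; have mw : measurable_fun setT (fun x : R => 2 * x `^ (- 2 - 1)).
  by apply: measurable_funM; [exact: measurable_cst|exact: measurable_powR].
rewrite -powR_invn ?(ltW b0)// -(integral_powR_tail b0 (ltr0n _ 2)).
rewrite -integral_itv_obnd_cbnd; last first.
  apply/measurable_EFinP; exact: measurable_funTS.
rewrite integral_mkcond; apply: ge0_le_integral => //.
- move=> x _; rewrite patchE; case: ifPn => // _.
  by rewrite lee_fin mulr_ge0 ?powR_ge0.
- apply/(measurable_restrictT _ _).1 => //; apply/measurable_EFinP; exact: measurable_funTS.
- by apply/measurable_EFinP; apply: measurable_funM => //; exact: measurable_indic.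
- move=> x _; rewrite patchE; case: ifPn => [|_].
    by rewrite inE => /bS xS; rewrite indicE mem_set// mulr1.
  by rewrite lee_fin !mulr_ge0 ?powR_ge0.
Qed.

(** The inverse square of [Num.max c `|l|] is the integral of [2 * y ^ -3] over
    the [y >= c] such that [`|l| <= y]. By Tonelli, its integral is that of
    [2 * y ^ -3 * mu ]-y, y]] over [y >= c], and the hypothesis on [mu] leaves
    an integral of a power. *)
Lemma layer_cake_bound (R : realType)
    (mu : {finite_measure set (measurableTypeR R) -> \bar R}) (A alpha c : R) :
  0 < A -> alpha < 2 -> 0 < c ->
  (forall d, 0 < d -> (mu `](- d)%R, d]%classic <= (A * d `^ alpha)%:E)%E) ->
  (\int[mu]_l ((Num.max c `|l|) ^- 2)%:E <=
    (A * (2 / (2 - alpha)) * c `^ (alpha - 2))%:E)%E.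
Proof.
move=> A0 a2 c0 muA.
pose w (x : R) : R := 2 * x `^ (- 2 - 1).
have w0 x : 0 <= w x by rewrite mulr_ge0 ?powR_ge0.
(* the region under the layers: c <= y and - y < l <= y *)
pose S : set (measurableTypeR R * measurableTypeR R) :=
  [set z | c <= z.2] `&` (~` [set z | z.1 <= - z.2] `&` [set z | z.1 <= z.2]).
pose h (z : measurableTypeR R * measurableTypeR R) : \bar R := (w z.2 * \1_S z)%:E.
have mfst : measurable_fun setT (fun z : measurableTypeR R * measurableTypeR R => z.1 : R).
  exact: measurable_fst.
have msnd : measurable_fun setT (fun z : measurableTypeR R * measurableTypeR R => z.2 : R).
  exact: measurable_snd.
have mS : measurable S.
  apply: measurableI; [|apply: measurableI; [apply: measurableC|]].
  - by rewrite -[X in measurable X]setTI; apply: measurable_fun_le => //; exact: measurable_cst.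
  - rewrite -[X in measurable X]setTI; apply: measurable_fun_le => //.
    exact: measurableT_comp.
  - by rewrite -[X in measurable X]setTI; apply: measurable_fun_le.
have mw : measurable_fun setT w.
  by apply: measurable_funM; [exact: measurable_cst|exact: measurable_powR].
have mh : measurable_fun setT h.
  apply/measurable_EFinP; apply: measurable_funM; last exact: measurable_indic.
  exact: (measurableT_comp mw msnd).
have h0 z : (0 <= h z)%E by rewrite lee_fin mulr_ge0.
have := @fubini_tonelli _ _ _ _ _ mu (@lebesgue_measure R) h mh h0 => F.
have mtail (k r : R) : measurable_fun setT (fun y : R => (r * y `^ k)%:E).
  apply/measurable_EFinP; apply: measurable_funM; first exact: measurable_cst.
  exact: measurable_powR.
apply: (@le_trans _ _ (\int[mu]_x \int[lebesgue_measure]_y h (x, y)))%E.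
  apply: ge0_le_integral => //.
  - by move=> l _; rewrite lee_fin invr_ge0 sqr_ge0.
  - exact: measurable_max_normN2.
  - exact: (measurable_fun_fubini_tonelli_F h mh h0).
  - move=> l _; set b := Num.max c `|l|.
    have b0 : 0 < b by rewrite /b lt_max c0.
    apply: (@tail_section_ge R b [set y | S (l, y)] b0).
      move=> y /=; rewrite in_itv/= andbT /b gt_max => /andP[cy].
      rewrite ltr_norml => /andP[yl ly]; split; first exact: ltW.
      by split; [apply/negP; rewrite -ltNge|exact: ltW].
    by have := measurable_xsection l mS; rewrite xsectionE.
rewrite F.
apply: (@le_trans _ _ (\int[@lebesgue_measure R]_(y in `[c, +oo[)
    (2 * A / (2 - alpha) * ((2 - alpha) * y `^ (- (2 - alpha) - 1)))%:E)%E).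
  rewrite [leRHS]integral_mkcond; apply: ge0_le_integral => //.
  - by move=> y _; apply: integral_ge0.
  - exact: (measurable_fun_fubini_tonelli_G h mh h0).
  - apply/(measurable_restrictT _ _).1 => //; apply: measurable_funTS.
    by under eq_fun do rewrite mulrA; exact: mtail.
  - move=> y _; rewrite patchE; case: ifPn => [|yc]; last first.
      rewrite integral0_eq// => x _; rewrite /h indicE memNset ?mulr0// => -[cy _].
      by move: yc; rewrite notin_setE/= in_itv/= andbT; apply.
    rewrite inE/= in_itv/= andbT => cy; have y0 : 0 < y by exact: lt_le_trans cy.
    have -> : (\int[mu]_x h (x, y) = (w y)%:E * mu `](- y)%R, y]%classic)%E.
      rewrite -[in RHS](setIT `](- y)%R, y]%classic) -integral_indic//.
      rewrite -ge0_integralZl_EFin//.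
        apply: eq_integral => x _; rewrite /h.
        rewrite -EFinM; congr (EFin (_ * _)).
        rewrite !indicE (_ : ((x, y) \in S) = (x \in `](- y)%R, y]%classic))//.
        apply/idP/idP => /set_mem.
          move=> [_ [/negP + /= xy]]; rewrite -ltNge => yx.
          by apply: mem_set; rewrite /= in_itv/= yx xy.
        rewrite /= in_itv/= => /andP[yx xy]; apply: mem_set; split => //.
        by split => //; apply/negP; rewrite -ltNge.
      by apply/measurable_EFinP; exact: measurable_indic.
    apply: (@le_trans _ _ ((w y)%:E * (A * y `^ alpha)%:E)%E).
      by rewrite lee_pmul2l ?muA// lte_fin mulr_gt0 ?powR_gt0.
    rewrite -EFinM lee_fin /w (_ : - (2 - alpha) - 1 = (- 2 - 1) + alpha); last by ring.
    rewrite (@powRD _ _ _ alpha); last by apply/implyP => _; rewrite gt_eqF.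
    rewrite le_eqVlt; apply/orP; left; apply/eqP. field.
    by rewrite subr_eq0 gt_eqF.
under eq_integral do rewrite EFinM.
rewrite ge0_integralZl_EFin//=.
- rewrite integral_powR_tail ?subr_gt0// -EFinM lee_fin opprB.
  by rewrite le_eqVlt; apply/orP; left; apply/eqP; ring.
- by move=> y _; rewrite lee_fin mulr_ge0 ?powR_ge0 ?subr_ge0 ?ltW.
- by apply: measurable_funTS; exact: mtail.
- by rewrite divr_ge0 ?mulr_ge0 ?subr_ge0 ?ltW.
Qed.

(** * The constant rho *)

(** Subtracting a multiple of [pi] does not change the square of the sine. *)
Lemma sin_sqr_reduce (R : realType) (x : R) : 0 < x -> sin x != 0 ->
  exists y : R, [/\ 0 < y, y < pi, y <= x & sin y ^+ 2 = sin x ^+ 2].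
Proof.
move=> x0; have [n xn] : exists n : nat, x < n%:R * pi.
  exists (Num.bound (x / pi)); rewrite -ltr_pdivrMr ?pi_gt0//.
  by rewrite archi_boundP// divr_ge0 ?pi_ge0// ltW.
elim: n x x0 xn => [|n IH] x x0 xn sx.
  by move: xn; rewrite mul0r ltNge ltW.
 have [xpi|pix] := ltP x pi; first by exists x.
have xpi0 : 0 < x - pi.
  by rewrite subr_gt0 lt_neqAle pix andbT; apply: contraNneq sx => <-; rewrite sinpi.
have sE : sin x = - sin (x - pi) by rewrite -[in LHS](subrK pi x) sinDpi.
have [||y [y0 ypi yx ys]] := IH _ xpi0.
- by rewrite ltrBlDr -[X in _ + X]mul1r -mulrDl natr1.
- by rewrite -oppr_eq0 -sE.
exists y; split => //; last by rewrite ys sE sqrrN.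
by rewrite (le_trans yx)// gerBl pi_ge0.
Qed.

(** The numerator increases while the denominator is [pi]-periodic, so that the
    infimum is not changed by restricting it to ]0, pi[, where the lower bound of the
    cardinal sine is available. *)
Lemma rho_ge (R : realType) (alpha m : R) : alpha <= 2 ->
  (forall x : R, 0 < x -> x < pi -> m <= x `^ (2 - alpha) / sin x ^+ 2) ->
  m <= rho alpha.
Proof.
move=> a2 mle; apply: lb_le_inf.
  exists ((pi / 2) `^ (2 - alpha) / sin (pi / 2) ^+ 2), (pi / 2) => //=.
  by rewrite sin_pihalf oner_neq0 divr_gt0 ?pi_gt0.
move=> _ [x [x0 sx] <-].
have [y [y0 ypi yx ys]] := sin_sqr_reduce x0 sx.
rewrite (le_trans (mle y y0 ypi))// ys ler_wpM2r ?invr_ge0 ?sqr_ge0//.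
by apply: ge0_ler_powR; rewrite ?subr_ge0 ?nnegrE// ltW.
Qed.

(** The infimum is at most the value at [pi / 2], where the sine is 1. *)
Lemma rho_le (R : realType) (alpha : R) :
  rho alpha / 2 `^ alpha <= pi `^ (2 - alpha) / 4.
Proof.
rewrite ler_pdivrMr ?powR_gt0//.
apply: (@le_trans _ _ ((pi / 2) `^ (2 - alpha))).
  apply: ge_inf; first by exists 0 => _ [x _ <-]; rewrite divr_ge0 ?powR_ge0 ?sqr_ge0.
  exists (pi / 2); first by rewrite /= sin_pihalf oner_neq0 divr_gt0 ?pi_gt0.
  by rewrite sin_pihalf expr1n divr1.
rewrite powRM ?pi_ge0// -[2^-1]powR_inv1// -powRrM mulN1r opprB.
rewrite (@powRB _ 2 alpha 2); last by apply/implyP => _; rewrite pnatr_eq0.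
by rewrite (powR_mulrn 2)// le_eqVlt; apply/orP; left; apply/eqP; field.

Qed.

(** * The two implications *)

Theorem mainTheorem1 (R : realType) (H : hilbertType R)
    (U : R -> {linear H -> H}) (hU : is_unitary_group U)
    (P : H -> H) (hP : is_orthogonal_projection (fixed_vectors U) P)
    (E : spectralFamily H) (hE : is_spectral_resolution U E)
    (alpha : R) (halpha0 : 0 <= alpha) (halpha2 : alpha < 2) (f : H) :
  (forall A : R, 0 < A ->
    (forall delta : R, 0 < delta ->
      (spectral_measure E (f - P f)%R `](- delta)%R, delta]%classic
         <= (A * delta `^ alpha)%:E)%E) ->
    forall t s : R, s < t ->
      `|ergodic_mean U t s f - P f| ^+ 2
        <= (2 `^ (alpha + 1) / (2 - alpha) * A * (t - s) `^ (- alpha))%:C)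
  /\
  (forall B : R, 0 < B ->
    (forall t s : R, s < t ->
      `|ergodic_mean U t s f - P f| ^+ 2 <= (B * (t - s) `^ (- alpha))%:C) ->
    (forall delta : R, 0 < delta ->
      (spectral_measure E (f - P f)%R `](- delta)%R, delta]%classic
         <= (rho alpha / 2 `^ alpha * B * delta `^ alpha)%:E)%E)
    /\ rho alpha / 2 `^ alpha * B <= pi `^ (2 - alpha) / 4 * B).
Proof.
set mu := spectral_mass E (f - P f).
have normE t s : s < t ->
    mu.-integrable setT (fun l => (trig_prim_sqr s t l / (t - s) ^+ 2)%:E) /\
    `|ergodic_mean U t s f - P f| ^+ 2 =
    (\int[mu]_l (trig_prim_sqr s t l / (t - s) ^+ 2))%:C.
  move=> st; have [ti _] := trig_prim_sqr_bounded_cvg mu (ltW st).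
  split; first by under eq_fun do rewrite mulrC EFinM; exact: integrableZl.
  by rewrite (ergodic_mean_norm hU hE hP)// -RintegralZl//;
    congr (_%:C); apply: eq_Rintegral => l _; rewrite mulrC.
split=> [A A0 muA t s st|B B0 normB].
- have [ti ->] := normE t s st; rewrite lecR.
  have ts0 : 0 < t - s by rewrite subr_gt0.
  have c0 : 0 < 2 / (t - s) by rewrite divr_gt0.
  rewrite -lee_fin fineK ?integrable_fin_num//.
  have := @layer_cake_bound R mu A alpha (2 / (t - s)) A0 halpha2 c0 muA => cake.
  set c := 2 / (t - s) in c0 cake.
  have mm := measurable_max_normN2 c0.
  apply: (@le_trans _ _ (\int[mu]_l ((c ^+ 2)%:E * ((Num.max c `|l|) ^- 2)%:E))%E).
    apply: ge0_le_integral => //.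
    + by move=> l _; rewrite lee_fin divr_ge0 ?sqr_ge0// addr_ge0 ?sqr_ge0.
    + exact: (measurable_int mu ti).
    + exact: measurable_funeM.
    + by move=> l _; rewrite -EFinM lee_fin trig_prim_sqr_le.
  rewrite ge0_integralZl_EFin ?sqr_ge0//; last first.
    by move=> l _; rewrite lee_fin invr_ge0 sqr_ge0.
  apply: (@le_trans _ _ ((c ^+ 2)%:E * (A * (2 / (2 - alpha)) * c `^ (alpha - 2))%:E)%E).
    by rewrite lee_wpmul2l// lee_fin sqr_ge0.
  rewrite -EFinM lee_fin powRB; last by apply/implyP => _; rewrite gt_eqF.
  rewrite (powR_mulrn 2 (ltW c0)) /c powRM ?invr_ge0 ?(ltW ts0)//.
  rewrite -powR_inv1 ?(ltW ts0)// -powRrM mulN1r.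
  rewrite powRD ?powRr1//; last by apply/implyP => _; rewrite pnatr_eq0.
  rewrite powR_inv1 ?(ltW ts0)// le_eqVlt; apply/orP; left; apply/eqP; field.
  by rewrite !gt_eqF// subr_gt0.
split; last by rewrite ler_wpM2r ?rho_le// ltW.
move=> d d0.
have muE : mu `](- d)%R, d]%classic = (fine (mu `](- d)%R, d]%classic))%:E.
  by rewrite fineK// fin_num_measure.
rewrite -[spectral_measure _ _ _]/(mu _) muE lee_fin.
set m := fine _ in muE *.
have K0 : 0 < B * d `^ alpha / 2 `^ alpha.
  by rewrite !mulr_gt0 ?invr_gt0 ?powR_gt0.
rewrite (_ : _ * _ * _ = rho alpha * (B * d `^ alpha / 2 `^ alpha)); last by ring.
rewrite -ler_pdivrMr//; apply: rho_ge (ltW halpha2) _ => x x0 xpi.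
have sx0 : 0 < sin x by rewrite sin_gt0_pi// x0.
rewrite ler_pdivrMr//.
(* the averaging time for which the frequency d corresponds to the argument x
   of the cardinal sine *)
set t := 2 * x / d; have t0 : 0 < t by rewrite /t divr_gt0 ?mulr_gt0.
have xE : (t - 0) * d / 2 = x by rewrite /t subr0; field; rewrite gt_eqF.
have [ti nE] := normE t 0 t0.
have := normB t 0 t0; rewrite nE lecR -lee_fin fineK ?integrable_fin_num//.
set T := fun l => _ in ti * => normT.
have q0 : 0 < sin x ^+ 2 / x ^+ 2 by rewrite divr_gt0 ?exprn_gt0.
(* restrict the spectral integral to ]-d, d], where the kernel is at least its
   value at d *)
have qm : sin x ^+ 2 / x ^+ 2 * m <= B * t `^ (- alpha).
  rewrite -lee_fin EFinM -muE -integral_cst//.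
  rewrite subr0 in normT; apply: le_trans normT.
  apply: (@le_trans _ _ (\int[mu]_(l in `](- d)%R, d]) T l)%E).
    apply: ge0_le_integral => //.
    + by move=> l _; rewrite lee_fin ltW.
    + exact: measurable_funTS (measurable_int mu ti).
    + move=> l /=; rewrite in_itv/= => /andP[dl ld]; rewrite lee_fin.
      rewrite -[X in sin X]xE -[X in _ / X ^+ 2]xE.
      apply: trig_prim_sqr_ge => //; last by rewrite xE ltW.
      by rewrite ler_norml ltW.
  apply: ge0_subset_integral => //; first exact: measurable_int ti.
  by move=> l _; rewrite lee_fin divr_ge0 ?sqr_ge0// addr_ge0 ?sqr_ge0.
rewrite mulrC -ler_pdivlMr// in qm; apply: (le_trans qm).
have -> : t `^ (- alpha) = x `^ (- alpha) * d `^ alpha / 2 `^ alpha.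
  rewrite /t powRM ?invr_ge0 ?mulr_ge0 ?(ltW x0) ?(ltW d0)//.
  rewrite powRM ?(ltW x0)// -[d^-1]powR_inv1 ?(ltW d0)// -powRrM mulN1r opprK.
  by rewrite (powRN 2); ring.
rewrite (@powRD _ x 2); last by apply/implyP => _; rewrite gt_eqF.
rewrite (powR_mulrn 2 (ltW x0)) le_eqVlt; apply/orP; left; apply/eqP; field.
by rewrite !gt_eqF// powR_gt0.
Qed.
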